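(* Let $R=\mathbb Z_N[\mathbb Z^D]$, let $\mathbf f=(f_1,\dots,f_s)$ be a regular sequence in $R$, let $\mathbf L=(L_1,\dots,L_D)\in\mathbb Z_{>0}^D$, and set $\mathbf b:=(x_1^{L_1}-1,\dots,x_D^{L_D}-1)$, $S:=R/(\mathbf f)$, $R_{\mathbf L}:=R/(\mathbf b)$. Then the $Z$-logical module in degree $j$ satisfies $$\mathcal H_j^Z(\mathbf L)\;\cong_{R_{\mathbf L}}\;\operatorname{Tor}_j^R(S,R_{\mathbf L})=\operatorname{Tor}_j^R\bigl(R/(\mathbf f),R/(\mathbf b)\bigr).$$
   Context: $R=\mathbb Z_N[x_1^{\pm1},\dots,x_D^{\pm1}]$. A sequence $(f_1,\dots,f_s)$ is regular if $f_1$ is a non-zero-divisor in $R$ and each $f_i$ ($2\le i\le s$) is a non-zero-divisor on $R/(f_1,\dots,f_{i-1})$. The Koszul complex $K_\bullet(\mathbf f)$: $K_i(\mathbf f)=\bigwedge^iR^s$, $\partial_i(e_{a_1}\wedge\cdots\wedge e_{a_i})=\sum_{k=1}^i(-1)^{k-1}f_{a_k}e_{a_1}\wedge\cdots\widehat{e_{a_k}}\cdots\wedge e_{a_i}$; $K_\bullet(\mathbf f;M):=K_\bullet(\mathbf f)\otimes_RM$. The $Z$-logical module of the degree-$j$ periodic Koszul-complex code of size $\mathbf L$ ($0\le j\le s$) is $$\mathcal H_j^Z(\mathbf L):=H_j\bigl(K_\bullet(\mathbf f;R_{\mathbf L})\bigr)=\frac{\ker(\partial_j\otimes\operatorname{id}_{R_{\mathbf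 L}})}{\operatorname{im}(\partial_{j+1}\otimes\operatorname{id}_{R_{\mathbf L}})}.$$ *)

(* Defs.v *)
From HB Require Import structures.
From mathcomp Require Import all_boot all_order all_algebra.
From mathcomp Require Import finmap monalg.
From mathcomp Require Import boolp.

Set Implicit Arguments.
Unset Strict Implicit.
Unset Printing Implicit Defensive.

Import GRing.Theory.
Local Open Scope ring_scope.
Local Open Scope quotient_scope.

Definition lmod_iso (R : pzRingType) (U V : lmodType R) : Prop :=
  exists phi : {linear U -> V}, bijective phi.

Section Quotient.
Variables (R : pzRingType) (V : lmodType R) (X : V -> Prop).

Inductive span : V -> Prop :=
| span_gen x : X x -> span x
| span_zero : span 0
| span_add x y : span x -> span y -> span (x + y)
| span_scale a x : span x -> span (a *: x).

Definition in_span : {pred V} := fun x => `[< span x >].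

Lemma in_spanP x : reflect (span x) (x \in in_span).
Proof. exact: asboolP. Qed.

Fact in_span_zmod_closed : zmod_closed in_span.
Proof.
split=> [|x y /in_spanP sx /in_spanP sy]; apply/in_spanP.
  exact: span_zero.
by rewrite -scaleN1r; apply: span_add => //; apply: span_scale.
Qed.
HB.instance Definition _ :=
  GRing.isZmodClosed.Build V in_span in_span_zmod_closed.

(* V modulo the submodule generated by X *)
Definition quotmod : Type := Quotient.quot in_span.

HB.instance Definition _ := GRing.Zmodule.on quotmod.

Definition quot_pi (x : V) : quotmod := \pi_(Quotient.quot in_span) x.

Fact quot_pi_eq x y : (quot_pi x = quot_pi y) <-> span (x - y).
Proof.
split=> [/eqP|sxy]; last apply/eqP.
  by rewrite -Quotient.idealrBE => /in_spanP.
by rewrite -Quotient.idealrBE; apply/in_spanP.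
Qed.

Fact quot_pi_surj (u : quotmod) : quot_pi (repr (u : Quotient.quot in_span)) = u.
Proof. exact: reprK. Qed.

Fact quot_piD x y : quot_pi (x + y) = quot_pi x + quot_pi y.
Proof. exact: Quotient.pi_add. Qed.

Definition quot_scale (a : R) (u : quotmod) : quotmod :=
  quot_pi (a *: repr (u : Quotient.quot in_span)).

Fact quot_scale_pi a x : quot_scale a (quot_pi x) = quot_pi (a *: x).
Proof.
apply/quot_pi_eq; rewrite -scalerBr; apply: span_scale.
by apply/quot_pi_eq; rewrite quot_pi_surj.
Qed.

Fact quot_scaleA a b u : quot_scale a (quot_scale b u) = quot_scale (a * b) u.
Proof. by rewrite -[u]quot_pi_surj !quot_scale_pi scalerA. Qed.

Fact quot_scale1 : left_id 1 quot_scale.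
Proof. by move=> u; rewrite -[u]quot_pi_surj quot_scale_pi scale1r. Qed.

Fact quot_scaleDr : right_distributive quot_scale +%R.
Proof.
move=> a u v; rewrite -[u]quot_pi_surj -[v]quot_pi_surj.
by rewrite -quot_piD !quot_scale_pi scalerDr quot_piD.
Qed.

Fact quot_scaleDl u : {morph quot_scale^~ u : a b / a + b}.
Proof.
by move=> a b; rewrite -[u]quot_pi_surj !quot_scale_pi scalerDl quot_piD.
Qed.

HB.instance Definition _ := GRing.Zmodule_isLmodule.Build R quotmod
  quot_scaleA quot_scale1 quot_scaleDr quot_scaleDl.

Fact quot_pi_is_linear : linear quot_pi.
Proof. by move=> a x y; rewrite quot_piD -quot_scale_pi. Qed.
HB.instance Definition _ :=
  GRing.isLinear.Build R V quotmod *:%R quot_pi quot_pi_is_linear.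

Section Lift.
Variables (W : lmodType R) (h : {linear V -> W}).
Hypothesis hX : forall x, X x -> h x = 0.

Definition quot_lift (u : quotmod) : W :=
  let _ := hX in h (repr (u : Quotient.quot in_span)).

Fact span_ker x : span x -> h x = 0.
Proof.
elim=> {x} [||x y _ hx _ hy|a x _ hx].
- exact: hX.
- exact: linear0.
- by rewrite linearD hx hy addr0.
- by rewrite linearZ /= hx scaler0.
Qed.

Fact quot_liftE x : quot_lift (quot_pi x) = h x.
Proof.
rewrite /quot_lift; apply/eqP; rewrite -subr_eq0 -linearB; apply/eqP/span_ker.
by apply/quot_pi_eq; rewrite quot_pi_surj.
Qed.

Fact quot_lift_is_linear : linear quot_lift.
Proof.
move=> a u v; rewrite -[u]quot_pi_surj -[v]quot_pi_surj.
by rewrite -linearP !quot_liftE linearP.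
Qed.
HB.instance Definition _ :=
  GRing.isLinear.Build R quotmod W *:%R quot_lift quot_lift_is_linear.

End Lift.
End Quotient.

Section Kernel.
Variables (R : pzRingType) (V W : lmodType R) (h : {linear V -> W}).

Definition in_ker : {pred V} := fun x => h x == 0.

Fact in_ker_submod_closed : subsemimod_closed in_ker.
Proof.
split; first split=> [|x y]; rewrite ?inE /in_ker /in_mem /=.
- by rewrite linear0.
- by move=> /eqP hx /eqP hy; rewrite linearD hx hy addr0.
- by move=> a x; rewrite /in_mem /= => /eqP hx; rewrite linearZ /= hx scaler0.
Qed.

Record kermod : Type := KerMod { ker_val :> V; _ : ker_val \in in_ker }.

HB.instance Definition _ := [isSub for ker_val].
HB.instance Definition _ := [Choice of kermod by <:].
HB.instance Definition _ := GRing.SubChoice_isSubLmodule.Build R V in_ker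
  kermod in_ker_submod_closed.

Fact ker_valP (x : kermod) : h (ker_val x) = 0.
Proof. by case: x => x /= /eqP. Qed.

Fact ker_val_is_linear : linear ker_val.
Proof. by []. Qed.
HB.instance Definition _ :=
  GRing.isLinear.Build R kermod V *:%R ker_val ker_val_is_linear.

End Kernel.

Section QuotientRing.
Variables (R : comPzRingType) (X : R -> Prop).

(* R modulo the ideal generated by X; it is both an R-module and a ring *)
Definition quotring : Type := @quotmod R R^o X.

HB.instance Definition _ := GRing.Lmodule.on quotring.

Definition rpi (x : R) : quotring := @quot_pi R R^o X x.

Definition quotring_mul (u v : quotring) : quotring :=
  rpi (repr (u : Quotient.quot (@in_span R R^o X)) * repr (v : Quotient.quot (@in_span R R^o X))).

Fact rpi_surj (u : quotring) : rpi (repr (u : Quotient.quot (@in_span R R^o X))) = u.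
Proof. exact: quot_pi_surj. Qed.

Fact rpiM x y : rpi (x * y) = quotring_mul (rpi x) (rpi y).
Proof.
have rpiZ (a b : R) : rpi (a * b) = a *: rpi b.
  exact: (linearZ_LR (@quot_pi R R^o X : {linear _ -> _}) a b).
by rewrite /quotring_mul [RHS]rpiZ rpi_surj -rpiZ [in RHS]mulrC
  [RHS]rpiZ rpi_surj -rpiZ mulrC.
Qed.

Fact quotring_mulA : associative quotring_mul.
Proof.
by move=> u v w; rewrite -[u]rpi_surj -[v]rpi_surj -[w]rpi_surj -!rpiM mulrA.
Qed.

Fact quotring_mulC : commutative quotring_mul.
Proof. by move=> u v; rewrite -[u]rpi_surj -[v]rpi_surj -!rpiM mulrC. Qed.

Fact quotring_mul1 : left_id (rpi 1) quotring_mul.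
Proof. by move=> u; rewrite -[u]rpi_surj -rpiM mul1r. Qed.

Fact quotring_mulDl : left_distributive quotring_mul +%R.
Proof.
have rpiD (a b : R) : rpi (a + b) = rpi a + rpi b by exact: quot_piD.
move=> u v w; rewrite -[u]rpi_surj -[v]rpi_surj -[w]rpi_surj.
by rewrite -rpiD -!rpiM mulrDl rpiD.
Qed.

HB.instance Definition _ := GRing.Zmodule_isComPzRing.Build quotring
  quotring_mulA quotring_mulC quotring_mul1 quotring_mulDl.

Fact rpi_is_zmod_morphism : zmod_morphism rpi.
Proof. exact: (raddfB (@quot_pi R R^o X : {additive _ -> _})). Qed.
HB.instance Definition _ :=
  GRing.isZmodMorphism.Build R quotring rpi rpi_is_zmod_morphism.

Fact rpi_is_monoid_morphism : monoid_morphism rpi.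
Proof. by split=> // x y; apply: rpiM. Qed.
HB.instance Definition _ :=
  GRing.isMonoidMorphism.Build R quotring rpi rpi_is_monoid_morphism.

End QuotientRing.

(* Finitely supported functions K -> R.  monalg only gives {malg R[K]} an
   R-module structure when 1 != 0 in R, whence this copy. *)
Section FreeModule.
Variables (R : pzRingType) (K : choiceType).

Definition freemod : Type := {malg R[K]}.
HB.instance Definition _ := GRing.Zmodule.on freemod.

Definition coef (x : freemod) (k : K) : R := mcoeff k (x : {malg R[K]}).
Definition supp (x : freemod) : {fset K} := msupp (x : {malg R[K]}).
Definition single (a : R) (k : K) : freemod := mkmalgU k a.

Fact coefP (x y : freemod) : coef x =1 coef y -> x = y.
Proof. by move=> exy; apply/malgP. Qed.
Fact coefD x y k : coef (x + y) k = coef x k + coef y k.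
Proof. exact: mcoeffD. Qed.
Fact coef_single a k l : coef (single a k) l = a *+ (k == l).
Proof. exact: mcoeffU. Qed.
Fact coef_sum (I : Type) (r : seq I) (F : I -> freemod) k :
  coef (\sum_(i <- r) F i) k = \sum_(i <- r) coef (F i) k.
Proof. exact: (raddf_sum (@mcoeff K R k : {additive _ -> _})). Qed.
Fact coef_out (x : freemod) k : k \notin supp x -> coef x k = 0.
Proof. exact: mcoeff_outdom. Qed.
Fact freeE (x : freemod) : x = \sum_(k <- supp x) single (coef x k) k.
Proof. exact: monalgE. Qed.

Definition free_scale (a : R) (x : freemod) : freemod :=
  \sum_(k <- supp x) single (a * coef x k) k.

Fact free_scaleE a x k : coef (free_scale a x) k = a * coef x k.
Proof.
rewrite [in RHS](freeE x) /free_scale !coef_sum mulr_sumr.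
by apply: eq_bigr => l _; rewrite !coef_single mulrnAr.
Qed.

Fact free_scaleA a b x : free_scale a (free_scale b x) = free_scale (a * b) x.
Proof. by apply: coefP => k; rewrite !free_scaleE mulrA. Qed.
Fact free_scale1 : left_id 1 free_scale.
Proof. by move=> x; apply: coefP => k; rewrite free_scaleE mul1r. Qed.
Fact free_scaleDr : right_distributive free_scale +%R.
Proof.
by move=> a x y; apply: coefP => k; rewrite !(free_scaleE, coefD) mulrDr.
Qed.
Fact free_scaleDl x : {morph free_scale^~ x : a b / a + b}.
Proof.
by move=> a b; apply: coefP => k; rewrite !(free_scaleE, coefD) mulrDl.
Qed.
HB.instance Definition _ := GRing.Zmodule_isLmodule.Build R freemod
  free_scaleA free_scale1 free_scaleDr free_scaleDl.

Fact coefZ a x k : coef (a *: x) k = a * coef x k.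
Proof. exact: free_scaleE. Qed.

Definition gen (k : K) : freemod := single 1 k.

Section FreeLift.
Variables (W : lmodType R) (g : K -> W).

Definition free_lift (x : freemod) : W := \sum_(k <- supp x) coef x k *: g k.

Fact free_liftw (x : freemod) (A : {fset K}) : (supp x `<=` A)%fset ->
  free_lift x = \sum_(k <- A) coef x k *: g k.
Proof.
move=> sxA; apply: big_fset_incl => // k _ /coef_out ->.
by rewrite scale0r.
Qed.

Fact free_lift_is_linear : linear free_lift.
Proof.
move=> a x y; pose A := (supp x `|` supp y `|` supp (a *: x + y)%R)%fset.
rewrite (@free_liftw x A); last by rewrite /A -fsetUA fsubsetUl.
rewrite (@free_liftw y A); last by rewrite /A fsubsetU // fsubsetUr.
rewrite (@free_liftw _ A); last by rewrite /A fsubsetUr.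
rewrite scaler_sumr -big_split; apply: eq_bigr => k _ /=.
by rewrite coefD coefZ scalerDl scalerA.
Qed.
HB.instance Definition _ :=
  GRing.isLinear.Build R freemod W *:%R free_lift free_lift_is_linear.

Fact free_lift_gen k : free_lift (gen k) = g k.
Proof.
rewrite (@free_liftw _ [fset k]%fset); last exact: msuppU_le.
by rewrite big_seq_fset1 coef_single eqxx scale1r.
Qed.

End FreeLift.

Fact free_ext (W : lmodType R) (h1 h2 : {linear freemod -> W}) :
  (forall k, h1 (gen k) = h2 (gen k)) -> h1 =1 h2.
Proof.
move=> h12 x; rewrite (freeE x) !linear_sum; apply: eq_bigr => k _.
have -> : single (coef x k) k = coef x k *: gen k.
  by apply: coefP => l; rewrite coefZ !coef_single mulrnAr mulr1.
by rewrite !linearZ h12.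
Qed.

End FreeModule.

(* For a ring morphism phi : R -> B, an R-module M and a B-module N (seen as
   an R-module through phi), the B-module M (x)_R N.  The free B-module on
   M * N is divided by additivity in M, B-linearity in N and R-balancedness,
   so that b acts by b (m (x) n) = m (x) b n.  For B = R and phi = id this is
   the usual tensor product of R-modules. *)
Section Tensor.
Variables (R B : comPzRingType) (phi : {rmorphism R -> B}).

Section Objects.
Variables (M : lmodType R) (N : lmodType B).

Let g (m : M) (n : N) : freemod B (M * N)%type := gen B (m, n).

Inductive tensor_rel : freemod B (M * N)%type -> Prop :=
| tensor_relDl m m' n : tensor_rel (g (m + m') n - (g m n + g m' n))
| tensor_relDr m n n' : tensor_rel (g m (n + n') - (g m n + g m n'))
| tensor_relZ m b n : tensor_rel (g m (b *: n) - b *: g m n)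
| tensor_relB m r n : tensor_rel (g (r *: m) n - g m (phi r *: n)).

Definition tensor : lmodType B := quotmod tensor_rel.

Definition tens (m : M) (n : N) : tensor := quot_pi tensor_rel (g m n).

Fact tensDl m m' n : tens (m + m') n = tens m n + tens m' n.
Proof.
rewrite /tens -quot_piD; apply/quot_pi_eq.
by apply: span_gen; apply: tensor_relDl.
Qed.
Fact tensDr m n n' : tens m (n + n') = tens m n + tens m n'.
Proof.
rewrite /tens -quot_piD; apply/quot_pi_eq.
by apply: span_gen; apply: tensor_relDr.
Qed.
Fact tensZr m b n : tens m (b *: n) = b *: tens m n.
Proof.
rewrite /tens -linearZ; apply/quot_pi_eq.
by apply: span_gen; apply: tensor_relZ.
Qed.
Fact tensB m r n : tens (r *: m) n = tens m (phi r *: n).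
Proof. by apply/quot_pi_eq; apply: span_gen; apply: tensor_relB. Qed.

Fact tensor_ext (W : lmodType B) (h1 h2 : {linear tensor -> W}) :
  (forall m n, h1 (tens m n) = h2 (tens m n)) -> h1 =1 h2.
Proof.
move=> h12 u; rewrite -[u]quot_pi_surj.
pose p := (quot_pi tensor_rel : {linear _ -> _}).
by apply: (@free_ext B _ W (h1 \o p) (h2 \o p)) => -[m n]; apply: h12.
Qed.

End Objects.

Section Functor.
Variables (M M' : lmodType R) (N : lmodType B) (h : {linear M -> M'}).

Definition tensor_pre : {linear freemod B (M * N)%type -> tensor M' N} :=
  free_lift (fun p : M * N => tens (h p.1) p.2).

Fact tensor_pre_rel x : tensor_rel x -> tensor_pre x = 0.
Proof.
have E m n : tensor_pre (gen B (m, n)) = tens (h m) n.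
  exact: free_lift_gen.
case=> [m m' n|m n n'|m b n|m r n]; rewrite linearB; apply/eqP;
  rewrite subr_eq0; apply/eqP; rewrite ?linearD ?linearZ /= !E.
- by rewrite linearD tensDl.
- by rewrite tensDr.
- by rewrite tensZr.
- by rewrite linearZ tensB.
Qed.

Definition tensor_map : {linear tensor M N -> tensor M' N} :=
  quot_lift tensor_pre_rel.

Fact tensor_mapE m n : tensor_map (tens m n) = tens (h m) n.
Proof.
apply: etrans (quot_liftE tensor_pre_rel _) _; exact: free_lift_gen.
Qed.

End Functor.
End Tensor.

Section Complexes.
Variable R : pzRingType.

Record complex := Complex {
  ob :> nat -> lmodType R;
  diff : forall n, {linear ob n.+1 -> ob n};
  diffK : forall n x, diff n (diff n.+1 x) = 0
}.

(* the differential leaving degree n, which is 0 for n = 0 *)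
Definition diff_out (C : complex) (n : nat) : {linear C n -> C n.-1} :=
  match n with
  | 0 => (\0 : {linear C 0%N -> C 0%N})
  | m.+1 => diff C m
  end.

Definition cycles (C : complex) (n : nat) : lmodType R :=
  kermod (diff_out C n).

Definition boundary (C : complex) (n : nat) (z : cycles C n) : Prop :=
  exists y : C n.+1, diff C n y = ker_val z.

Definition homology (C : complex) (n : nat) : lmodType R :=
  quotmod (@boundary C n).

End Complexes.

Section TensorComplex.
Variables (R B : comPzRingType) (phi : {rmorphism R -> B}).
Variables (C : complex R) (N : lmodType B).

Fact tensor_diffK n x :
  tensor_map phi N (diff C n) (tensor_map phi N (diff C n.+1) x) = 0.
Proof.
pose h1 := tensor_map phi N (diff C n).
pose h2 := tensor_map phi N (diff C n.+1).
apply: (@tensor_ext _ _ phi _ _ _ (h1 \o h2) \0) => m y.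
apply: etrans (congr1 h1 (tensor_mapE phi (diff C n.+1) m y)) _.
apply: etrans (tensor_mapE phi (diff C n) _ y) _; rewrite diffK.
by rewrite -(scale0r (0 : C n)) tensB rmorph0 tensZr scale0r.
Qed.

Definition tensor_complex : complex B :=
  @Complex B (fun n => tensor phi (C n) N)
    (fun n => tensor_map phi N (diff C n)) tensor_diffK.

End TensorComplex.

Section Projective.
Variable R : pzRingType.

Definition surjective (U V : Type) (h : U -> V) : Prop :=
  forall v, exists u, h u = v.

Definition projective (P : lmodType R) : Prop :=
  forall (U V : lmodType R) (q : {linear U -> V}) (h : {linear P -> V}),
    surjective q -> exists h' : {linear P -> U}, forall x, q (h' x) = h x.

Definition projective_resolution (M : lmodType R) (P : complex R)
    (eps : {linear P 0%N -> M}) : Prop :=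
  [/\ forall n, projective (P n),
      surjective eps,
      forall x, eps x = 0 <-> exists y, diff P 0 y = x
    & forall n x, diff P n x = 0 <-> exists y, diff P n.+1 y = x].

(* The standard free resolution: P_0 is the free module on the elements of M,
   and P_(n+1) the free module on the elements of ker (P_n -> P_(n-1)). *)
Variable M : lmodType R.

Definition free_cover (V : lmodType R) : {linear freemod R V -> V} :=
  free_lift (fun v : V => v).

Fixpoint syzygy (n : nat) : lmodType R :=
  if n is m.+1 then kermod (free_cover (syzygy m)) else M.

Definition res_ob (n : nat) : lmodType R := freemod R (syzygy n).

Definition res_diff (n : nat) : {linear res_ob n.+1 -> res_ob n} :=
  (@ker_val R _ _ (free_cover (syzygy n)) : {linear _ -> _})
    \o free_cover (syzygy n.+1).

Fact res_diffK n x : res_diff n (res_diff n.+1 x) = 0.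
Proof. by rewrite /= ker_valP linear0. Qed.

Definition std_resolution : complex R := Complex res_diffK.

Definition std_augmentation : {linear std_resolution 0%N -> M} := free_cover M.

Lemma free_coverK (V : lmodType R) v : free_cover V (gen R v) = v.
Proof. exact: free_lift_gen. Qed.

Lemma free_projective (K : choiceType) : projective (freemod R K).
Proof.
move=> U V q h q_surj.
have ex k : exists u, q u == h (gen R k).
  by have [u <-] := q_surj (h (gen R k)); exists u.
exists (free_lift (fun k => xchoose (ex k))).
apply: (@free_ext R K V (q \o free_lift (fun k => xchoose (ex k))) h) => k /=.
by rewrite free_lift_gen; apply/eqP; apply: (xchooseP (ex k)).
Qed.

Lemma std_resolutionP : projective_resolution std_augmentation.
Proof.
have exact_at n (x : res_ob n) :
    free_cover (syzygy n) x = 0 <-> exists y, res_diff n y = x.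
  split=> [x0|[y <-]]; last exact: ker_valP.
  have xK : x \in in_ker (free_cover (syzygy n)) by apply/eqP.
  exists (gen R (KerMod xK : syzygy n.+1)).
  by rewrite /res_diff /= free_coverK.
split=> [n|v||n x].
- exact: free_projective.
- by exists (gen R v); apply: free_coverK.
- exact: exact_at.
- rewrite -exact_at; split=> x0; first by apply: val_inj.
  exact: (congr1 (@ker_val R _ _ (free_cover (syzygy n))) x0).
Qed.

End Projective.

(* Tor_j^R(M, N) for an R-module M and a B-module N, seen as an R-module
   through phi; it inherits the B-action of N. *)
Definition Tor (R B : comPzRingType) (phi : {rmorphism R -> B}) (j : nat)
    (M : lmodType R) (N : lmodType B) : lmodType B :=
  homology (tensor_complex phi (std_resolution M) N) j.

Section Koszul.
Variables (R : comPzRingType) (s : nat) (f : 'I_s -> R).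

(* The i-th exterior power of R^s, as the free module on the e_A for A a
   subset of cardinality i, where e_A stands for the wedge of the e_a, a in A,
   taken in increasing order. *)
Definition koszul_ob (i : nat) : lmodType R :=
  {ffun {A : {set 'I_s} | #|A| == i} -> R^o}.

Definition wedge (i : nat) (A : {set 'I_s}) : koszul_ob i :=
  [ffun B => (val B == A)%:R].

(* The differential of e_A: if a is the k-th element of A then exactly k - 1
   elements of A lie below a, so that the sign is (-1)^(k-1). *)
Definition wedge_diff (i : nat) (A : {set 'I_s}) : koszul_ob i :=
  \sum_(a in A)
    ((-1) ^+ #|[set b in A | (b < a)%N]| * f a) *: wedge i (A :\ a).

Definition koszul_fun (i : nat) (x : koszul_ob i.+1) : koszul_ob i :=
  \sum_(A : {A : {set 'I_s} | #|A| == i.+1}) x A *: wedge_diff i (val A).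

Fact koszul_fun_is_linear i : linear (@koszul_fun i).
Proof.
move=> c x y; rewrite /koszul_fun scaler_sumr -big_split.
by apply: eq_bigr => A _; rewrite !ffunE scalerDl scalerA.
Qed.
HB.instance Definition _ i := GRing.isLinear.Build R (koszul_ob i.+1)
  (koszul_ob i) *:%R (@koszul_fun i) (@koszul_fun_is_linear i).

Definition koszul_diff (i : nat) : {linear koszul_ob i.+1 -> koszul_ob i} :=
  @koszul_fun i.

Fact koszul_diffE i (A : {set 'I_s}) : #|A| == i.+1 ->
  koszul_diff i (wedge i.+1 A) = wedge_diff i A.
Proof.
move=> cA; rewrite /= /koszul_fun (bigD1 (exist _ A cA)) //= ffunE /= eqxx.
rewrite scale1r big1 ?addr0 // => B neB; rewrite ffunE.
case: eqP => [eBA|_]; last by rewrite scale0r.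
by case/eqP: neB; apply: val_inj.
Qed.

Fact wedge_diffK i (A : {set 'I_s}) : #|A| == i.+2 ->
  koszul_diff i (wedge_diff i.+1 A) = 0.
Proof.
move=> cA; pose pos (B : {set 'I_s}) (a : 'I_s) := #|[set b in B | (b < a)%N]|.
pose t a b := ((-1) ^+ pos A a * f a) *:
  (((-1) ^+ pos (A :\ a) b * f b) *: wedge i (A :\ a :\ b)).
have tN a b : a \in A -> b \in A -> (a < b)%N -> t b a = - t a b.
  move=> aA bA ab; rewrite /t !scalerA -scaleNr.
  have -> : A :\ b :\ a = A :\ a :\ b by apply/setP => c; rewrite !inE andbCA.
  have -> : pos (A :\ b) a = pos A a.
    apply: eq_card => c; rewrite !inE; case: eqP => //= ->.
    by rewrite ltnNge (ltnW ab) andbF.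
  have -> : pos A b = (pos (A :\ a) b).+1.
    rewrite /pos (cardsD1 a) inE aA ab add1n; congr _.+1.
    by apply: eq_card => c; rewrite !inE andbA.
  congr (_ *: _); rewrite exprS mulN1r !mulNr; congr (- _).
  by rewrite mulrACA [RHS]mulrACA [f b * _]mulrC [X in X * _]mulrC.
rewrite linear_sum /=.
rewrite (eq_bigr (fun a => \sum_(b in A | b != a) t a b)); last first.
  move=> a aA; rewrite linearZ_LR.
  have cAa : #|A :\ a| == i.+1.
    by move: cA; rewrite (cardsD1 a) aA add1n eqSS.
  rewrite (koszul_diffE cAa) /wedge_diff.
  apply: etrans (scaler_sumr _ _ _ _) _; apply: eq_bigl => b.
  by rewrite !inE andbC.
rewrite (eq_bigr (fun a : 'I_s => \sum_(b in A | (b < a)%N) t a b +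
                           \sum_(b in A | (a < b)%N) t a b)); last first.
  move=> a aA; rewrite (bigID (fun b : 'I_s => (b < a)%N)) /=.
  congr (_ + _); apply: eq_bigl => b; rewrite -andbA; congr (_ && _).
    by rewrite andb_idl // => ba; rewrite neq_ltn ba.
  by rewrite -leqNgt ltn_neqAle eq_sym.
rewrite big_split /=; apply/eqP; rewrite addr_eq0 -sumrN; apply/eqP.
rewrite (exchange_big_dep (mem A)) => [|a b aA /andP[] //] /=.
apply: eq_bigr => a aA; rewrite -sumrN.
apply: eq_big => [b|b /andP[bA /andP[_ ab]]].
  by rewrite aA.
exact: tN.
Qed.

Fact koszul_diffK i x : koszul_diff i (koszul_diff i.+1 x) = 0.
Proof.
rewrite [X in koszul_diff i X]/= /koszul_fun -/(koszul_diff i) raddf_sum.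
rewrite big1 // => -[A cA] _.
apply: etrans (linearZ_LR (koszul_diff i) _ _) _.
by rewrite wedge_diffK // scaler0.
Qed.

Definition koszul : complex R := Complex koszul_diffK.

(* Each f_i is a non-zero-divisor on R / (f_k, k < i) for every i; no assumption
   R / (f) <> 0 is made *)
Definition regular_sequence : Prop :=
  forall (i : 'I_s)
    (u : quotring (fun r : R => exists2 k : 'I_s, (k < i)%N & r = f k)),
    f i *: u = 0 -> u = 0.

Definition gens : R -> Prop := fun r => exists k : 'I_s, r = f k.

End Koszul.

(* monalg's product on {malg A[G]} is for monoids G without non-trivial
   inverses, so the ring structure is rebuilt for an additive group G. *)
Section GroupRing.
Variables (A : comNzRingType) (G : zmodType).

Definition groupring : Type := {malg A[G]}.
HB.instance Definition _ := GRing.Zmodule.on groupring.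

Implicit Types x y z : groupring.

Definition gr_single (a : A) (g : G) : groupring := mkmalgU g a.
Definition gr_coef (x : groupring) (g : G) : A := mcoeff g (x : {malg A[G]}).
Definition gr_supp (x : groupring) : {fset G} := msupp (x : {malg A[G]}).

Definition gr_mul x y : groupring :=
  \sum_(g <- gr_supp x) \sum_(h <- gr_supp y)
    gr_single (gr_coef x g * gr_coef y h) (g + h).

Definition gr_one : groupring := gr_single 1 0.

Fact gr_coef_out x g : g \notin gr_supp x -> gr_coef x g = 0.
Proof. exact: mcoeff_outdom. Qed.
Fact gr_single0 g : gr_single 0 g = 0.
Proof. exact: monalgU0. Qed.
Fact gr_singleD a b g : gr_single (a + b) g = gr_single a g + gr_single b g.
Proof. exact: monalgUD. Qed.
Fact gr_coefD x y g : gr_coef (x + y) g = gr_coef x g + gr_coef y g.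
Proof. exact: mcoeffD. Qed.
Fact gr_coefU a g h : gr_coef (gr_single a g) h = a *+ (g == h).
Proof. exact: mcoeffU. Qed.
Fact gr_suppU a g : (gr_supp (gr_single a g) `<=` [fset g])%fset.
Proof. exact: msuppU_le. Qed.
Fact grE x : x = \sum_(g <- gr_supp x) gr_single (gr_coef x g) g.
Proof. exact: monalgE. Qed.

Fact gr_mulw (d e : {fset G}) x y :
  (gr_supp x `<=` d)%fset -> (gr_supp y `<=` e)%fset ->
  gr_mul x y = \sum_(g <- d) \sum_(h <- e)
    gr_single (gr_coef x g * gr_coef y h) (g + h).
Proof.
move=> xd ye; rewrite /gr_mul (big_fset_incl _ xd) /=.
  apply: eq_bigr => g _; apply: big_fset_incl => // h _ /gr_coef_out ->.
  by rewrite mulr0 gr_single0.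
move=> g _ /gr_coef_out xg.
by rewrite big1 // => h _; rewrite xg mul0r gr_single0.
Qed.

Fact gr_mulC : commutative gr_mul.
Proof.
move=> x y; rewrite /gr_mul exchange_big; apply: eq_bigr => g _.
by apply: eq_bigr => h _; rewrite mulrC addrC.
Qed.

Fact gr_mulDl : left_distributive gr_mul +%R.
Proof.
move=> x y z; pose d := (gr_supp x `|` gr_supp y `|` gr_supp (x + y)%R)%fset.
rewrite (@gr_mulw d (gr_supp z) x) //; last by rewrite /d -fsetUA fsubsetUl.
rewrite (@gr_mulw d (gr_supp z) y) //; last by rewrite /d fsubsetU // fsubsetUr.
rewrite (@gr_mulw d (gr_supp z)) //; last by rewrite /d fsubsetUr.
rewrite -big_split; apply: eq_bigr => g _.
rewrite -big_split; apply: eq_bigr => h _ /=.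
by rewrite gr_coefD mulrDl gr_singleD.
Qed.

Fact gr_mulDr : right_distributive gr_mul +%R.
Proof. by move=> x y z; rewrite !(gr_mulC x) gr_mulDl. Qed.

Fact gr_mul0 x : gr_mul 0 x = 0.
Proof. by apply: (addrI (gr_mul 0 x)); rewrite -gr_mulDl !addr0. Qed.

Fact gr_mulUU a b g h :
  gr_mul (gr_single a g) (gr_single b h) = gr_single (a * b) (g + h).
Proof.
rewrite (gr_mulw (gr_suppU _ _) (gr_suppU _ _)) !big_seq_fset1.
by rewrite !gr_coefU !eqxx.
Qed.

Fact gr_mul_suml (I : Type) (r : seq I) (F : I -> groupring) y :
  gr_mul (\sum_(i <- r) F i) y = \sum_(i <- r) gr_mul (F i) y.
Proof.
by apply: (big_morph (gr_mul^~ y)) => [u v|]; [apply: gr_mulDl|apply: gr_mul0].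
Qed.

Fact gr_mul_sumr (I : Type) (r : seq I) (F : I -> groupring) y :
  gr_mul y (\sum_(i <- r) F i) = \sum_(i <- r) gr_mul y (F i).
Proof.
by rewrite gr_mulC gr_mul_suml; apply: eq_bigr => i _; rewrite gr_mulC.
Qed.

Fact gr_mulA : associative gr_mul.
Proof.
move=> x y z; rewrite [x]grE [y]grE [z]grE !gr_mul_suml.
apply: eq_bigr => g _; rewrite [LHS]gr_mul_sumr.
rewrite [X in _ = gr_mul X _]gr_mul_sumr gr_mul_suml.
apply: eq_bigr => h _; rewrite [RHS]gr_mul_sumr.
rewrite [X in gr_mul _ X = _]gr_mul_sumr [LHS]gr_mul_sumr.
by apply: eq_bigr => k _; rewrite !gr_mulUU mulrA addrA.
Qed.

Fact gr_mul1 : left_id gr_one gr_mul.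
Proof.
move=> x; rewrite {1}[x]grE gr_mul_sumr [RHS]grE; apply: eq_bigr => g _.
by rewrite gr_mulUU mul1r add0r.
Qed.

Fact gr_one_neq0 : gr_one != 0.
Proof.
apply/eqP => /(congr1 (fun x => gr_coef x 0)).
rewrite gr_coefU eqxx /gr_coef mcoeff0; exact/eqP/oner_neq0.
Qed.

HB.instance Definition _ := GRing.Zmodule_isComNzRing.Build groupring
  gr_mulA gr_mulC gr_mul1 gr_mulDl gr_one_neq0.

End GroupRing.

(* Z_N[x_1^{+-1}, ..., x_D^{+-1}], as the group ring Z_N[Z^D].  'Z_N is the
   ring of integers modulo N only for N > 1. *)
Definition laurent (N D : nat) : comNzRingType :=
  groupring 'Z_N {ffun 'I_D -> int}.

Definition lvar (N D : nat) (i : 'I_D) : laurent N D :=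
  gr_single 1 [ffun k => (k == i)%:R].

Section Code.
Variables (N D s : nat) (f : 'I_s -> laurent N D) (L : 'I_D -> nat).

Definition period (i : 'I_D) : laurent N D := lvar N i ^+ L i - 1.

Definition S_mod : lmodType (laurent N D) := quotring (gens f).

Definition R_L : comPzRingType := quotring (gens period).

Definition to_R_L : {rmorphism laurent N D -> R_L} :=
  @rpi (laurent N D) (gens period).

Definition Z_logical (j : nat) : lmodType R_L :=
  homology (tensor_complex to_R_L (koszul f) R_L^o) j.

End Code.

(* Main.v *)
(** Both sides compute the homology of a projective resolution of R/(f) tensored
    with the same module, and any two such resolutions are homotopy equivalent.
    That the Koszul complex of a regular sequence resolves R/(f) is shown by
    induction on the number m of generators in use.  Write x = x0 + x1 /\ e_m
    with x0, x1 free of e_m; then d x = 0 says d x1 = 0 and d x0 = f_m x1 up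
    to a sign depending on the degree.
    Regularity puts the degree-0 part of x1 in (f_k, k < m), so x1 = d y1, and
    subtracting from x0 a multiple f_m y1, with the same signs, leaves a cycle of
    the shorter complex. *)

Require Import Defs.
From HB Require Import structures.
From mathcomp Require Import all_boot all_order all_algebra.
From mathcomp Require Import boolp.

Set Implicit Arguments.
Unset Strict Implicit.
Unset Printing Implicit Defensive.

Import GRing.Theory.
Local Open Scope ring_scope.

(** * Lifting out of projective modules, and choice degree by degree *)

Section KernelCorestriction.
Variables (R : pzRingType) (U V W : lmodType R).
Variables (g : {linear U -> V}) (h : {linear V -> W}).
Hypothesis hg0 : forall x, h (g x) = 0.

Fact ker_corestr_subproof x : g x \in in_ker h.
Proof. exact/eqP/hg0. Qed.

Definition ker_corestr (x : U) : kermod h := KerMod (ker_corestr_subproof x).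

Fact ker_corestr_is_linear : linear ker_corestr.
Proof. by move=> a x y; apply: val_inj; rewrite /= linearP. Qed.
HB.instance Definition _ :=
  GRing.isLinear.Build R U (kermod h) *:%R ker_corestr ker_corestr_is_linear.

End KernelCorestriction.

(** Exactness makes [d] a surjection of [U] onto [ker e]; since [h] also lands in [ker e],
    projectivity lifts it there. *)
Lemma projective_lift_exact (R : pzRingType) (P U V W : lmodType R)
    (d : {linear U -> V}) (e : {linear V -> W}) (h : {linear P -> V}) :
    projective P -> (forall x, e x = 0 <-> exists y, d y = x) ->
    (forall x, e (h x) = 0) ->
  exists h' : {linear P -> U}, forall x, d (h' x) = h x.
Proof.
move=> Pproj ex eh0.
have ed0 y : e (d y) = 0 by apply/ex; exists y.
have q_surj : surjective (ker_corestr ed0).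
  move=> v; have /ex[y dy] := ker_valP v.
  by exists y; apply: val_inj.
have [h' h'E] := Pproj _ _ (ker_corestr ed0) (ker_corestr eh0) q_surj.
by exists h' => x; apply: (congr1 (@ker_val _ _ _ e) (h'E x)).
Qed.

(** Serves to build families of maps one degree at a time. The invariant [good] guarantees that the
    next choice is possible, and the recursion carries its proof along in a sigma type. *)
Lemma dependent_choice_nat (T : nat -> Type) (good : forall n, T n -> Prop)
    (step : forall n, T n -> T n.+1 -> Prop) (t0 : T 0%N) :
    good 0%N t0 ->
    (forall n t, good n t -> exists2 t', good n.+1 t' & step n t t') ->
  exists2 F : forall n, T n, F 0%N = t0 & forall n, step n (F n) (F n.+1).
Proof.
move=> good0 next.
pose nx n (t : {t : T n | good n t}) := cid2 (next n (sval t) (svalP t)).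
pose fix F n : {t : T n | good n t} :=
  if n is m.+1 then exist _ (s2val (nx m (F m))) (s2valP (nx m (F m)))
  else exist _ t0 good0.
by exists (fun n => sval (F n)) => // n; apply: (s2valP' (nx n (F n))).
Qed.

(** * Chain maps, null homotopies and the comparison of resolutions *)

Definition chain_map (R : pzRingType) (C D : complex R)
    (phi : forall n, {linear C n -> D n}) : Prop :=
  forall n x, diff D n (phi n.+1 x) = phi n (diff C n x).

Definition null_homotopy (R : pzRingType) (C D : complex R)
    (phi : forall n, {linear C n -> D n})
    (h : forall n, {linear C n -> D n.+1}) : Prop :=
  (forall x, phi 0%N x = diff D 0 (h 0%N x)) /\
  (forall n x, phi n.+1 x = diff D n.+1 (h n.+1 x) + h n (diff C n x)).

Section Comparison.
Variables (R : pzRingType) (M : lmodType R) (P Q : complex R).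
Variables (epsP : {linear P 0%N -> M}) (epsQ : {linear Q 0%N -> M}).
Hypotheses (resP : projective_resolution epsP).
Hypotheses (resQ : projective_resolution epsQ).

Lemma resolution_chain_map : exists phi : forall n, {linear P n -> Q n},
  (forall x, epsQ (phi 0%N x) = epsP x) /\ chain_map phi.
Proof.
case: resP resQ => Pproj _ Pex0 Pex [_ Qsurj Qex0 Qex].
have [phi0 phi0E] := Pproj 0%N _ _ epsQ epsP Qsurj.
(* The invariant says that [t] after the differential of [P] takes values in boundaries of [Q],
   which is what lifting to the next degree requires. *)
pose good n (t : {linear P n -> Q n}) :=
  forall x, exists y, diff Q n y = t (diff P n x).
have good0 : good 0%N phi0.
  by move=> x; apply/Qex0; rewrite phi0E; apply/Pex0; exists x.
have [n t tgood|phi phi_0 phiS] := dependent_choice_nat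
    (step := fun n (t : {linear P n -> Q n}) (t' : {linear P n.+1 -> Q n.+1}) =>
               forall x, diff Q n (t' x) = t (diff P n x)) good0.
  have [t' t'E] : exists t' : {linear P n.+1 -> Q n.+1},
      forall x, diff Q n (t' x) = (t \o diff P n : {linear _ -> _}) x.
    (* Exactness of [Q] at degree 0 is relative to [epsQ], and in higher degrees relative to the
       differential. *)
    case: n t tgood => [|n] t tgood.
      by apply: (projective_lift_exact (Pproj _) Qex0) => x; apply/Qex0/tgood.
    by apply: (projective_lift_exact (Pproj _) (Qex n)) => x; apply/Qex/tgood.
  by exists t' => // x; apply/Qex; rewrite t'E /= diffK linear0.
by exists phi; split=> //; rewrite phi_0.
Qed.

Lemma null_homotopic_of_augmentation (phi : forall n, {linear P n -> Q n}) :
  chain_map phi -> (forall x, epsQ (phi 0%N x) = 0) ->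
  exists h : forall n, {linear P n -> Q n.+1}, null_homotopy phi h.
Proof.
case: resP resQ => Pproj _ _ _ [_ _ Qex0 Qex] phiC eps_phi.
have [h0 h0E] := projective_lift_exact (Pproj 0%N) Qex0 eps_phi.
(* What the homotopy built so far fails to account for in degree [n.+1] is a cycle, so exactness of
   [Q] and projectivity of [P n.+1] give the next component. *)
pose good n (t : {linear P n -> Q n.+1}) :=
  forall x, diff Q n (phi n.+1 x - t (diff P n x)) = 0.
have good0 : good 0%N h0 by move=> x; rewrite linearB h0E /= phiC subrr.
have [n t tgood|h h_0 hS] := dependent_choice_nat
    (step := fun n (t : {linear P n -> Q n.+1}) (t' : {linear P n.+1 -> Q n.+2}) =>
       forall x, diff Q n.+1 (t' x) = phi n.+1 x - t (diff P n x)) good0.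
  have [t' t'E] := projective_lift_exact
    (h := (phi n.+1 \- (t \o diff P n))) (Pproj n.+1) (Qex n) tgood.
  exists t' => // x.
  by rewrite linearB t'E /= diffK linear0 subr0 phiC subrr.
exists h; split=> [x|n x]; first by rewrite h_0.
by rewrite hS subrK.
Qed.

End Comparison.

(** The difference of [psi] after [phi] and the identity is a chain map covering zero on [M], hence
    null-homotopic. *)
Lemma resolution_homotopy_retract (R : pzRingType) (M : lmodType R)
    (P Q : complex R) (epsP : {linear P 0%N -> M}) (epsQ : {linear Q 0%N -> M})
    (phi : forall n, {linear P n -> Q n}) (psi : forall n, {linear Q n -> P n}) :
    projective_resolution epsP ->
    chain_map phi -> (forall x, epsQ (phi 0%N x) = epsP x) ->
    chain_map psi -> (forall x, epsP (psi 0%N x) = epsQ x) ->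
  exists h, null_homotopy (fun n => (psi n \o phi n) \- idfun) h.
Proof.
move=> resP phiC phi0 psiC psi0.
apply: (null_homotopic_of_augmentation resP resP) => [n x|x] /=.
  by rewrite linearB /= psiC phiC.
by rewrite linearB /= psi0 phi0 subrr.
Qed.

(** * Maps induced on homology *)

Section HomologyMap.
Variables (R : pzRingType) (C D : complex R).
Variables (phi : forall n, {linear C n -> D n}) (phiC : chain_map phi).
Variable j : nat.

Lemma diff_out_chain_map x :
  diff_out D j (phi j x) = phi j.-1 (diff_out C j x).
Proof. by case: j x => [|n] x /=; rewrite ?linear0 ?phiC. Qed.

Lemma diff_out_cycle (z : cycles C j) :
  diff_out D j ((phi j \o @ker_val _ _ _ (diff_out C j)) z) = 0.
Proof. by rewrite /= diff_out_chain_map ker_valP linear0. Qed.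

Definition cycles_map : {linear cycles C j -> cycles D j} :=
  ker_corestr diff_out_cycle.

Lemma cycles_map_boundary z :
  boundary z -> (@quot_pi R _ (@boundary R D j) \o cycles_map) z = 0.
Proof.
case=> y dy; rewrite /= -(linear0 (quot_pi (@boundary R D j))).
apply/quot_pi_eq; rewrite subr0; apply: span_gen.
by exists (phi j.+1 y); rewrite phiC dy.
Qed.

Definition homology_map : {linear homology C j -> homology D j} :=
  quot_lift cycles_map_boundary.

Lemma homology_map_pi z :
  homology_map (quot_pi _ z) = quot_pi _ (cycles_map z).
Proof. exact: (quot_liftE cycles_map_boundary). Qed.

End HomologyMap.

(** On a cycle [z] the term of the homotopy that involves the differential of [z] vanishes (in
    degree 0 there is none), so the round trip moves [z] by the boundary of [h j z]. *)
Lemma homology_mapK (R : pzRingType) (C D : complex R)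
    (phi : forall n, {linear C n -> D n}) (psi : forall n, {linear D n -> C n})
    (phiC : chain_map phi) (psiC : chain_map psi) h :
    null_homotopy (fun n => (psi n \o phi n) \- idfun) h ->
  forall j, cancel (homology_map phiC j) (homology_map psiC j).
Proof.
move=> [h0 hS] j u; rewrite -[u]quot_pi_surj !homology_map_pi.
apply/quot_pi_eq/span_gen; move: (repr _) => z; exists (h j (ker_val z)).
case: j u z => [|j] u z; first by rewrite -h0.
have := hS j (ker_val z); rewrite (ker_valP z : diff C j _ = 0) linear0 addr0.
by move=> <-.
Qed.

(** * Tensoring chain maps and homotopies; independence of the resolution *)

Section TensorFunctor.
Variables (R B : comPzRingType) (phi : {rmorphism R -> B}) (N : lmodType B).

Lemma tensor_map_chain (C D : complex R) (g : forall n, {linear C n -> D n}) :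
  chain_map g ->
  @chain_map _ (tensor_complex phi C N) (tensor_complex phi D N)
    (fun n => tensor_map phi N (g n)).
Proof.
move=> gC n.
apply: (@tensor_ext _ _ phi _ _ _
  (tensor_map phi N (diff D n) \o tensor_map phi N (g n.+1))
  (tensor_map phi N (g n) \o tensor_map phi N (diff C n))) => m y.
rewrite -[LHS]/(tensor_map phi N (diff D n) (tensor_map phi N (g n.+1) _)).
rewrite -[RHS]/(tensor_map phi N (g n) (tensor_map phi N (diff C n) _)).
by rewrite !tensor_mapE gC.
Qed.

Lemma tensor_map_homotopy (C D : complex R)
    (g : forall n, {linear C n -> D n}) (k : forall n, {linear D n -> C n}) h :
    null_homotopy (fun n => (k n \o g n) \- idfun) h ->
  @null_homotopy _ (tensor_complex phi C N) (tensor_complex phi C N)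
    (fun n => (tensor_map phi N (k n) \o tensor_map phi N (g n)) \- idfun)
    (fun n => tensor_map phi N (h n)).
Proof.
have tensBl (M : lmodType R) (m m' : M) (y : N) :
    tens phi (m - m') y = tens phi m y - tens phi m' y.
  by apply/eqP; rewrite eq_sym subr_eq -tensDl subrK.
move=> [h0 hS]; split=> [|n].
  apply: (@tensor_ext _ _ phi _ _ _
    ((tensor_map phi N (k 0%N) \o tensor_map phi N (g 0%N)) \- idfun)
    (tensor_map phi N (diff C 0) \o tensor_map phi N (h 0%N))) => m y.
  rewrite -[LHS]/(tensor_map phi N (k 0%N) (tensor_map phi N (g 0%N) _) - _).
  rewrite -[RHS]/(tensor_map phi N (diff C 0) (tensor_map phi N (h 0%N) _)).
  by rewrite !tensor_mapE -h0 tensBl.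
apply: (@tensor_ext _ _ phi _ _ _
  ((tensor_map phi N (k n.+1) \o tensor_map phi N (g n.+1)) \- idfun)
  ((tensor_map phi N (diff C n.+1) \o tensor_map phi N (h n.+1)) \+
   (tensor_map phi N (h n) \o tensor_map phi N (diff C n)))) => m y.
rewrite -[LHS]/(tensor_map phi N (k n.+1) (tensor_map phi N (g n.+1) _) - _).
rewrite -[RHS]/(tensor_map phi N (diff C n.+1) (tensor_map phi N (h n.+1) _) +
                tensor_map phi N (h n) (tensor_map phi N (diff C n) _)).
by rewrite !tensor_mapE -tensDl -hS tensBl.
Qed.

End TensorFunctor.

Arguments tensor_map_chain {R B} phi N {C D g}.
Arguments tensor_map_homotopy {R B} phi N {C D g k h}.

Lemma tensor_homology_resolution (R B : comPzRingType)
    (phi : {rmorphism R -> B}) (N : lmodType B) (M : lmodType R)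
    (P Q : complex R) (epsP : {linear P 0%N -> M}) (epsQ : {linear Q 0%N -> M})
    (j : nat) :
    projective_resolution epsP -> projective_resolution epsQ ->
  lmod_iso (homology (tensor_complex phi P N) j)
           (homology (tensor_complex phi Q N) j).
Proof.
move=> resP resQ.
have [f [f0 fC]] := resolution_chain_map resP resQ.
have [g [g0 gC]] := resolution_chain_map resQ resP.
have [h hP] := resolution_homotopy_retract resP fC f0 gC g0.
have [k kP] := resolution_homotopy_retract resQ gC g0 fC f0.
exists (homology_map (tensor_map_chain phi N fC) j).
exists (homology_map (tensor_map_chain phi N gC) j).
  exact: (homology_mapK (tensor_map_chain phi N fC) (tensor_map_chain phi N gC)
    (tensor_map_homotopy phi N hP)).
exact: (homology_mapK (tensor_map_chain phi N gC) (tensor_map_chain phi N fC)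
  (tensor_map_homotopy phi N kP)).
Qed.

(** * Exactness of the Koszul differential, in all degrees at once *)

Section Exterior.
Variables (R : comPzRingType) (s : nat) (f : 'I_s -> R).

Implicit Types (x y z : {set 'I_s} -> R) (A B : {set 'I_s}) (a b : 'I_s).

Definition ext_sign B a : R := (-1) ^+ #|[set b in B | (b < a)%N]|.

(* A function x on subsets stands for the sum of the x A e_A over all degrees at
   once, and ext_diff is the Koszul differential read off in coordinates. *)
Definition ext_diff x B : R :=
  \sum_(a | a \notin B) ext_sign B a * f a * x (a |: B).

(** For [x] supported on sets below [a] this is the wedge with e_a on the right; there is no sign
    because [a] comes last. *)
Definition ext_wedge a x A : R := if a \in A then x (A :\ a) else 0.

Definition below (m : nat) A : bool := [forall a in A, (a < m)%N].

Definition ext_below m x : Prop := forall A, ~~ below m A -> x A = 0.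

Definition prefix_ideal (m : nat) : R -> Prop :=
  @Defs.span R R^o (fun r => exists2 k : 'I_s, (k < m)%N & r = f k).

Lemma ext_diffD x y B :
  ext_diff (fun A => x A + y A) B = ext_diff x B + ext_diff y B.
Proof.
by rewrite /ext_diff -big_split; apply: eq_bigr => a _; rewrite /= mulrDr.
Qed.

Lemma ext_diffZ c x B : ext_diff (fun A => c * x A) B = c * ext_diff x B.
Proof.
by rewrite /ext_diff mulr_sumr; apply: eq_bigr => a _; rewrite mulrCA.
Qed.

(** The differential lowers the degree by one, so it anticommutes with the degree sign. *)
Lemma ext_diff_sign x B :
  ext_diff (fun A => (-1) ^+ #|A| * x A) B = - ((-1) ^+ #|B| * ext_diff x B).
Proof.
rewrite /ext_diff mulr_sumr -sumrN; apply: eq_bigr => a aB.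
by rewrite cardsU1 aB add1n exprS mulN1r mulNr mulrN mulrCA.
Qed.

Lemma below_setU1 m a B : below m (a |: B) = (a < m)%N && below m B.
Proof.
apply/'forall_implyP/andP => [H|[am /'forall_implyP Bm] b].
  split; first by apply: H; rewrite setU11.
  by apply/'forall_implyP => b bB; apply: H; rewrite inE bB orbT.
by rewrite in_setU1 => /predU1P[->|] //; apply: Bm.
Qed.

Lemma ext_diff_below m x : ext_below m x -> ext_below m (ext_diff x).
Proof.
move=> xm B Bm; rewrite /ext_diff big1 // => a _.
by rewrite xm ?mulr0 // below_setU1 (negPf Bm) andbF.
Qed.

Lemma below_notin (a : 'I_s) A : below a A -> a \notin A.
Proof.
by move=> /'forall_implyP Aa; apply/negP => /Aa; rewrite ltnn.
Qed.

Lemma ext_sign_max (a : 'I_s) B : below a B -> ext_sign B a = (-1) ^+ #|B|.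
Proof.
move=> /'forall_implyP Ba; congr (_ ^+ _); apply: eq_card => b.
by rewrite inE andb_idr //; apply: Ba.
Qed.

Lemma ext_sign_setD1 (a m : 'I_s) B :
  (a < m)%N -> ext_sign (B :\ m) a = ext_sign B a.
Proof.
move=> am; congr (_ ^+ _); apply: eq_card => b; rewrite !inE.
by case: eqP => //= ->; rewrite ltnNge (ltnW am) andbF.
Qed.

(** Graded Leibniz rule: removing an index below [m] ignores the last factor e_m, while removing [m]
    itself passes all the other factors. *)
Lemma ext_diff_wedge (m : 'I_s) y B : ext_below m y ->
  ext_diff (ext_wedge m y) B =
  ext_wedge m (ext_diff y) B + f m * ((-1) ^+ #|B| * y B).
Proof.
move=> ym; have y0 A : m \in A -> y A = 0.
  by move=> mA; apply: ym; apply: contraL mA => /below_notin.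
rewrite /ext_diff /ext_wedge; have [mB|mB] := boolP (m \in B).
  rewrite (y0 B mB) !mulr0 addr0 [RHS](bigD1 m) ?inE ?eqxx //=.
  rewrite setD1K // (y0 B mB) mulr0 add0r.
  apply: eq_big => [a|a aB].
    rewrite !inE negb_and negbK; case: (eqVneq a m) => [->|].
      by rewrite mB.
    by rewrite andbT.
  have -> : (a |: B) :\ m = a |: (B :\ m).
    apply/setP => b; rewrite !inE; case: (eqVneq b a) => [->|] //.
    by rewrite andbT; apply: contraNneq aB => ->.
  rewrite inE mB orbT; have [am|am] := ltnP a m; first by rewrite ext_sign_setD1.
  by rewrite ym ?mulr0 // below_setU1 ltnNge am.
(* When [m] is not in [B], only the index [a = m] brings [m] into the set at which the wedge is
   evaluated. *)
rewrite add0r (bigD1 m) //= setU11 setU1K // big1 ?addr0; last first.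
  by move=> a /andP[_ am]; rewrite in_setU1 eq_sym (negPf am) (negPf mB) mulr0.
have [Bm|Bm] := boolP (below m B); last by rewrite ym ?mulr0.
by rewrite ext_sign_max // mulrA [f m * _]mulrC.
Qed.

Lemma prefix_ideal_regular (i : 'I_s) c : regular_sequence f ->
  prefix_ideal i (f i * c) -> prefix_ideal i c.
Proof.
move=> reg fc.
pose X r := exists2 k : 'I_s, (k < i)%N & r = f k.
pose p : {linear R^o -> quotring X} := @quot_pi R R^o X.
have : p (f i *: (c : R^o)) = 0.
  by rewrite -(linear0 p); apply/quot_pi_eq; rewrite subr0.
rewrite linearZ_LR => /(reg i); rewrite -(linear0 p) => /quot_pi_eq.
by rewrite subr0.
Qed.

Lemma prefix_idealS (i : 'I_s) c :
  prefix_ideal i.+1 c -> exists r, prefix_ideal i (c - r * f i).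
Proof.
elim=> {c} [c [k]||x y _ [r rP] _ [t tP]|a x _ [r rP]].
- rewrite ltnS leq_eqVlt => /predU1P[/val_inj -> ->|ki ->].
    by exists 1; rewrite mul1r subrr; apply: span_zero.
  by exists 0; rewrite mul0r subr0; apply: span_gen; exists k.
- by exists 0; rewrite mul0r subr0; apply: span_zero.
- exists (r + t); rewrite mulrDl opprD addrACA.
  exact: span_add.
- exists (a * r); rewrite -mulrA -[_ - _]mulrBr.
  exact: (span_scale a rP).
Qed.

Lemma prefix_ideal_diff m x : ext_below m x -> prefix_ideal m (ext_diff x set0).
Proof.
move=> xm; rewrite /ext_diff /prefix_ideal; apply: (big_ind (@Defs.span R R^o _)).
- exact: span_zero.
- exact: span_add.
move=> a _; have [am|am] := ltnP a m.
  rewrite mulrAC; apply: (@span_scale R R^o); apply: span_gen; by exists a.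
by rewrite xm ?mulr0; [apply: span_zero | rewrite below_setU1 ltnNge am].
Qed.

(** The cycle condition says nothing about the degree-0 coordinate, whose boundaries form the ideal
    of the first [m] generators; hence the separate condition on [x set0]. *)
Lemma ext_diff_exact : regular_sequence f -> forall m, (m <= s)%N ->
  forall x, ext_below m x -> (forall B, ext_diff x B = 0) ->
    prefix_ideal m (x set0) ->
  exists2 y, ext_below m y & forall B, ext_diff y B = x B.
Proof.
move=> reg; elim=> [|m IHm] ms x xm dx0 x0I.
  (* For [m = 0] only the empty set supports [x], and its coordinate lies in the zero ideal, so [x]
     is zero. *)
  exists (fun=> 0) => // B.
  rewrite /ext_diff big1 => [|a _]; last by rewrite mulr0.
  have [B0|Bn0] := boolP (below 0 B); last by rewrite xm.
  have -> : B = set0.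
    apply/setP => a; rewrite inE; apply/negP => aB.
    by have /'forall_implyP/(_ a aB) := B0.
  suff : x set0 = 0 by [].
  elim: x0I => // [r [] //|u v _ -> _ ->|a u _ ->]; first by rewrite addr0.
  by rewrite /GRing.scale /= mulr0.
pose i := Ordinal ms; have {}IHm := IHm (ltnW ms).
pose x0 A := if i \in A then 0 else x A.
pose x1 A := if i \in A then 0 else x (i |: A).
have belowS A : i \notin A -> below m.+1 A -> below m A.
  move=> iA /'forall_implyP Am; apply/'forall_implyP => b bA.
  have := Am b bA; rewrite ltnS leq_eqVlt => /predU1P[bm|//].
  by case/negP: iA; rewrite (_ : i = b) //; apply: val_inj.
have x0m : ext_below m x0.
  move=> A Am; rewrite /x0; case: ifPn => // iA; apply: xm.
  by apply: contra Am; apply: belowS.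
have x1m : ext_below m x1.
  move=> A Am; rewrite /x1; case: ifPn => // iA; apply: xm.
  by apply: contra Am; rewrite below_setU1 => /andP[_]; apply: belowS.
have xE A : x A = x0 A + ext_wedge i x1 A.
  rewrite /x0 /x1 /ext_wedge; case: ifP => iA; last by rewrite addr0.
  by rewrite add0r !inE eqxx setD1K.
have dxE B : ext_diff x B = ext_diff x0 B + (ext_wedge i (ext_diff x1) B
    + f i * ((-1) ^+ #|B| * x1 B)).
  rewrite -ext_diff_wedge // -ext_diffD; apply: eq_bigr => a _.
  by rewrite xE.
have notin_below (B : {set 'I_s}) : i \in B -> ~~ below m B.
  by apply: contraL; apply: (@below_notin i).
have dx1 B : ext_diff x1 B = 0.
  have [iB|iB] := boolP (i \in B).
    by apply: (ext_diff_below x1m); apply: notin_below.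
  have iU : i \in i |: B by rewrite setU11.
  (* At a set containing [i], both the differential of [x0] and the value of [x1] vanish, which
     isolates the differential of [x1]. *)
  have := dxE (i |: B); rewrite dx0 (ext_diff_below x0m) ?notin_below //.
  by rewrite {2}/x1 /ext_wedge iU setU1K // !mulr0 addr0 add0r => <-.
have dx0E B : ext_diff x0 B = - (f i * ((-1) ^+ #|B| * x1 B)).
  have := dxE B; rewrite dx0 /ext_wedge dx1 if_same add0r => /eqP.
  by rewrite eq_sym addr_eq0 => /eqP.
(* At the empty set, [f i * x1 set0] is up to sign a degree-0 boundary of the shorter complex;
   regularity cancels [f i]. *)
have x1I : prefix_ideal m (x1 set0).
  apply: (@prefix_ideal_regular i) => //.
  have := prefix_ideal_diff x0m; rewrite dx0E cards0 expr0 mul1r => H.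
  by have := @span_scale R R^o _ (-1) _ H; rewrite scaleN1r opprK.
have [y1 y1m y1E] := IHm x1 x1m dx1 x1I.
have [r rI] := @prefix_idealS i _ x0I.
(* Adding a multiple of the basis vector at the empty set to y1 does not change
   its differential, and brings the degree-0 part of the remainder into the
   ideal of the shorter sequence. *)
pose y1' A := y1 A + (r - y1 set0) * (A == set0)%:R.
have y1'm : ext_below m y1'.
  move=> A Am; rewrite /y1' y1m // add0r.
  case: eqP Am => [->|]; rewrite ?mulr0 //.
  by case/negP; apply/'forall_implyP => b; rewrite inE.
have y1'E B : ext_diff y1' B = x1 B.
  rewrite -y1E; apply: eq_bigr => a aB; congr (_ * _).
  by rewrite /y1' -cards_eq0 cardsU1 aB /= mulr0 addr0.
(* By the Leibniz rule the correction is the excess of the differential of [ext_wedge i y1'] over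
   [ext_wedge i x1]. It makes [w] a cycle, with [w set0] equal to [x set0 - r * f i]. *)
pose w A := x0 A + (- f i) * ((-1) ^+ #|A| * y1' A).
have [|B||y0 y0m y0E] := IHm w.
- by move=> A Am; rewrite /w x0m // y1'm // !mulr0 addr0.
- rewrite /w ext_diffD ext_diffZ ext_diff_sign y1'E dx0E.
  by rewrite mulrNN addNr.
- rewrite /w /x0 /y1' inE cards0 eqxx mulr1 expr0 mul1r [y1 _ + _]addrC subrK.
  by rewrite mulNr mulrC.
exists (fun A => y0 A + ext_wedge i y1' A) => [A Am|B].
  rewrite y0m ?add0r; last first.
    apply: contra Am => /'forall_implyP Am.
    by apply/'forall_implyP => b /Am /leqW.
  rewrite /ext_wedge; case: ifP => // iA; apply: y1'm; apply: contra Am.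
  rewrite -{2}(setD1K iA) below_setU1 ltnSn => /'forall_implyP Am.
  by apply/'forall_implyP => b /Am /leqW.
rewrite ext_diffD ext_diff_wedge // y0E xE /w /ext_wedge y1'E.
by rewrite mulNr addrACA addrAC addrA addrNK addrC.
Qed.

End Exterior.

(** * The Koszul complex as a projective resolution of the quotient by the sequence *)

Section KoszulResolution.
Variables (R : comPzRingType) (s : nat) (f : 'I_s -> R).

Implicit Types (z : {set 'I_s} -> R) (A B : {set 'I_s}) (a : 'I_s).

Definition ext_part i z : koszul_ob R s i := [ffun A => z (val A)].

(** The default 0 makes the result homogeneous of degree [i] among functions on all subsets. *)
Definition ext_extend i (x : koszul_ob R s i) A : R :=
  if insub A is Some A' then x A' else 0.

Lemma ext_extendK i (x : koszul_ob R s i) : ext_part i (ext_extend x) = x.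
Proof. by apply/ffunP => A; rewrite ffunE /ext_extend valK. Qed.

Lemma ext_extend_out i (x : koszul_ob R s i) A : #|A| != i -> ext_extend x A = 0.
Proof. by move=> Ai; rewrite /ext_extend insubN. Qed.

(** Both sides sum over pairs with [A = a |: B], one grouped by [A] and the other by [a]. The signs
    agree since [a] is not below itself. *)
Lemma koszul_diff_part i z :
  koszul_diff f i (ext_part i.+1 z) = ext_part i (ext_diff f z).
Proof.
have scaleE (u v : R) : u *: (v : R^o) = u * v by [].
apply/ffunP => -[B cB]; rewrite /= /koszul_fun sum_ffunE ffunE /=.
transitivity (\sum_(A : {A : {set 'I_s} | #|A| == i.+1})
    \sum_(a | (a \notin B) && (val A == a |: B))
      ext_sign R B a * f a * z (a |: B)).
  apply: eq_bigr => -[A cA] _; rewrite !ffunE /= /wedge_diff sum_ffunE.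
  rewrite [LHS]mulr_sumr big_mkcond [RHS]big_mkcond; apply: eq_bigr => a _.
  rewrite !ffunE /=; have [aA|aA] := boolP (a \in A); last first.
    rewrite (_ : A == _ = false) ?andbF //.
    by apply: contraNF aA => /eqP->; rewrite setU11.
  rewrite scaleE; case: (eqVneq B (A :\ a)) => [->|neBA].
    rewrite !inE eqxx setD1K // eqxx mulr1 mulrC; congr (_ ^+ _ * _ * _).
    apply: eq_card => b; rewrite !inE; case: eqP => //= ->.
    by rewrite ltnn andbF.
  rewrite !mulr0; case: ifP => // /andP[aB /eqP eA].
  by case/eqP: neBA; rewrite eA setU1K.
rewrite (exchange_big_dep (fun a => a \notin B)) /= => [|A a _ /andP[] //].
apply: eq_bigr => a aB; have cU : #|a |: B| == i.+1.
  by rewrite cardsU1 aB (eqP cB).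
by rewrite (big_pred1 (exist _ (a |: B) cU)) // => A /=; rewrite aB.
Qed.

Lemma koszul_projective i : projective (koszul_ob R s i).
Proof.
move=> U V q h q_surj; pose e A : koszul_ob R s i := wedge R i A.
have ex A : exists u, q u == h (e A).
  by have [u <-] := q_surj (h (e A)); exists u.
(* Chosen preimages of the images of the basis vectors, extended linearly. *)
pose g (x : koszul_ob R s i) : U :=
  \sum_(A : {A : {set 'I_s} | #|A| == i}) x A *: xchoose (ex (val A)).
have gL : linear g.
  move=> c x y; rewrite /g scaler_sumr -big_split; apply: eq_bigr => A _.
  by rewrite !ffunE scalerDl scalerA.
pose gM := GRing.isLinear.Build R _ _ _ g gL.
pose g' : {linear koszul_ob R s i -> U} := HB.pack g gM.
exists g' => x; rewrite /= /g linear_sum.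
have {2}-> : x = \sum_(A : {A : {set 'I_s} | #|A| == i}) x A *: e (val A).
  apply/ffunP => B; rewrite sum_ffunE (bigD1 B) //= !ffunE eqxx.
  rewrite [_ *: _]mulr1 big1 ?addr0 // => A neAB; rewrite !ffunE.
  by rewrite (inj_eq val_inj) eq_sym (negPf neAB) scaler0.
rewrite linear_sum; apply: eq_bigr => A _; rewrite !linearZ /=.
by congr (_ *: _); apply/eqP; apply: (xchooseP (ex (val A))).
Qed.

Fact card_set0_eq0 : #|set0 : {set 'I_s}| == 0%N.
Proof. by rewrite cards0. Qed.

Definition koszul_augmentation_fun (x : koszul f 0%N) : quotring (gens f) :=
  rpi (gens f) (x (exist _ set0 card_set0_eq0)).

Fact koszul_augmentation_is_linear : linear koszul_augmentation_fun.
Proof.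
move=> c x y; rewrite /koszul_augmentation_fun !ffunE.
exact: (linearP (@quot_pi R R^o (gens f) : {linear _ -> _})).
Qed.
HB.instance Definition _ := GRing.isLinear.Build R (koszul f 0%N)
  (quotring (gens f)) *:%R koszul_augmentation_fun koszul_augmentation_is_linear.

Definition koszul_augmentation : {linear koszul f 0%N -> quotring (gens f)} :=
  koszul_augmentation_fun.

Lemma below_all A : below s A.
Proof. by apply/'forall_implyP. Qed.

Lemma span_gens_prefix_ideal c :
  @Defs.span R R^o (gens f) c <-> prefix_ideal f s c.
Proof.
split; elim=> {c} [c|||].
- by case=> k ->; apply: span_gen; exists k.
- exact: span_zero.
- by move=> x y _ Ix _ Iy; apply: span_add.
- by move=> a x _; apply: span_scale.
- by case=> k _ ->; apply: span_gen; exists k.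
- exact: span_zero.
- by move=> x y _ Ix _ Iy; apply: span_add.
- by move=> a x _; apply: span_scale.
Qed.

Lemma koszul_augmentation_eq0 x : koszul_augmentation x = 0 <->
  prefix_ideal f s (x (exist _ set0 card_set0_eq0)).
Proof.
have <- : @quot_pi R R^o (gens f) 0 = 0.
  exact: (linear0 (@quot_pi R R^o (gens f) : {linear _ -> _})).
apply: (iff_trans (quot_pi_eq _ _ _)); rewrite subr0.
exact: span_gens_prefix_ideal.
Qed.

(** A preimage found in all degrees at once may be cut down to its part of degree [i.+1], as the
    differential is homogeneous. *)
Lemma koszul_ext_exact i (x : koszul f i) : regular_sequence f ->
    (forall B, ext_diff f (ext_extend x) B = 0) ->
    prefix_ideal f s (ext_extend x set0) ->
  exists y, koszul_diff f i y = x.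
Proof.
move=> reg dx0 x0I.
have xs : ext_below s (ext_extend x) by move=> A; rewrite below_all.
have [y _ yE] := ext_diff_exact reg (leqnn s) xs dx0 x0I.
exists (ext_part i.+1 y); rewrite koszul_diff_part -[RHS]ext_extendK.
by apply/ffunP => A; rewrite !ffunE yE.
Qed.

Lemma ext_extend_card (i : nat) (x : koszul_ob R s i) A (cA : #|A| == i) :
  ext_extend x A = x (exist _ A cA).
Proof. by rewrite -[in RHS](ext_extendK x) ffunE. Qed.

Lemma koszul_resolution :
  regular_sequence f -> projective_resolution koszul_augmentation.
Proof.
move=> reg; split=> [n|v|x|n x].
- exact: koszul_projective.
- exists (ext_part 0 (fun=> repr (v : Quotient.quot _))).
  by rewrite /= /koszul_augmentation_fun ffunE; apply: rpi_surj.
- rewrite koszul_augmentation_eq0 -ext_extend_card; split=> [x0I|[y <-]].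
    (* In degree 0 the cycle condition is automatic: [a |: B] is never empty. *)
    apply: koszul_ext_exact => // B; rewrite /ext_diff big1 // => a aB.
    by rewrite ext_extend_out ?mulr0 // cardsU1 aB.
  rewrite (ext_extend_card _ card_set0_eq0) -[y]ext_extendK.
  rewrite [diff _ _ _](koszul_diff_part 0 (ext_extend y)) ffunE; apply: prefix_ideal_diff => A.
  by rewrite below_all.
split=> [x0|[y <-]]; last exact: diffK.
apply: koszul_ext_exact => // [B|]; last first.
  by rewrite ext_extend_out ?cards0 //; apply: span_zero.
(* On sets of size [n] this is the hypothesis on [x]; elsewhere [a |: B] has the wrong size and
   every term is zero. *)
have [cB|cB] := boolP (#|B| == n).
  have := koszul_diff_part n (ext_extend x); rewrite ext_extendK [LHS]x0.
  by move=> /ffunP/(_ (exist _ B cB)); rewrite !ffunE.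
rewrite /ext_diff big1 // => a aB.
by rewrite ext_extend_out ?mulr0 // cardsU1 aB.
Qed.

End KoszulResolution.

Theorem fact3 (N D s : nat) (hN : (1 < N)%N) (f : 'I_s -> laurent N D)
  (hf : regular_sequence f) (L : 'I_D -> nat) (hL : forall i, (0 < L i)%N)
  (j : nat) (hj : (j <= s)%N) :
  lmod_iso (Z_logical f L j)
           (Tor (to_R_L N L) j (S_mod f) (R_L N L)^o).
Proof.
(* The coefficients are [R_L] as a module over itself, so the isomorphism is [R_L]-linear. *)
exact: tensor_homology_resolution (koszul_resolution hf) (std_resolutionP _).
Qed.
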